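(* Let $\mu=\prod_{n=1}^\infty\nu_n$ be a $b$-biased probability measure on $[0,1]^{\mathbb{N}}$ with $b>0$. Then $\mu(\mathcal{C}_I)=1$; that is, for $\mu$-almost every sequence $(p_i)_{i=1}^\infty$ the Condorcet Jury Property holds.
   Context: For a sequence $(p_i)_{i=1}^\infty\in[0,1]^{\mathbb{N}}$ let $X_1,X_2,\dots$ be independent random variables with values in $\{0,1\}$ and $\mathbb{P}(X_i=1)=p_i$. The sequence satisfies the Condorcet Jury Property (CJP) if $\lim_{n\to\infty,\ n\text{ odd}}\mathbb{P}\left(\sum_{i=1}^n X_i>\frac n2\right)=1$; $\mathcal{C}_I$ is the set of such sequences. All measures are Borel probability measures; $\nu\ll\nu'$ denotes absolute continuity. Hellinger integral: $H(\nu,\nu')=\int_{[0,1]}\sqrt{\frac{d\nu}{d\tau}\frac{d\nu'}{d\tau}}\,d\tau$ for any $\tau$ with $\nu,\nu'\ll\tau$. Class $\mathcal{D}$: a divergence ($d\ge0$, $d(\nu,\nu')=0$ iff $\nu=\nu'$) or distance (metric) $d$ on probability measures on $[0,1]$ belongs to $\mathcal{D}$ if there is $C>0$ with $1-H(\nu,\nu')\le C\,d(\nu,\nu')$ for all $\nu,\nu'$. $b$-biased measure ($b\in[-\frac12,\frac12]$): a product measure $\mu=\prod_{n=1}^\infty\nu_n$ on $[0,1]^{\mathbb{N}}$ such that there is a probability measure $\nu_0$ on $[0,1]$ with $\nu_n\ll\nu_0$ for all $n\ge1$, $\int_{[0,1]}x\,d\nu_0(x)=\frac12+b$, and $\sum_{n=1}^\infty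 d(\nu_n,\nu_0)<\infty$ for some $d\in\mathcal{D}$. *)

(* Defs.v *)
From HB Require Import structures.
From mathcomp Require Import all_boot all_order all_algebra.
From mathcomp Require Import all_classical all_reals all_analysis.
Set Implicit Arguments. Unset Strict Implicit. Unset Printing Implicit Defensive.
Import Order.TTheory GRing.Theory Num.Theory.
Import numFieldNormedType.Exports.
Local Open Scope classical_set_scope.
Local Open Scope ring_scope.

Section Defs.
Variable R : realType.

Definition on01 (nu : probability R R) : Prop := nu (`[0%R, 1%R]%classic) = 1%E.

(* Hellinger integral, as in the paper: for any tau with nu, nu' << tau and
   densities f = dnu/dtau, g = dnu'/dtau, H = \int_[0,1] sqrt(f g) dtau. *)
Definition hellinger_witness (nu nu' : probability R R)
  (tau : {measure set R -> \bar R}) (f g : R -> R) : Prop :=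
  measurable_fun setT f /\ measurable_fun setT g /\
  (forall x, 0 <= f x) /\ (forall x, 0 <= g x) /\
  (forall A : set R, measurable A -> A `<=` (`[0%R, 1%R]%classic) ->
     nu A = (\int[tau]_(x in A) (f x)%:E)%E /\
     nu' A = (\int[tau]_(x in A) (g x)%:E)%E).

Definition hellinger_value (tau : {measure set R -> \bar R}) (f g : R -> R) : \bar R :=
  (\int[tau]_(x in (`[0%R, 1%R]%classic)) (Num.sqrt (f x * g x))%:E)%E.

(* divergence on probability measures on [0,1] (a metric is in particular one) *)
Definition is_divergence (d : probability R R -> probability R R -> \bar R) : Prop :=
  forall nu nu' : probability R R, on01 nu -> on01 nu' ->
    (0 <= d nu nu')%E /\ (d nu nu' = 0%E <-> nu = nu').

Definition classD (d : probability R R -> probability R R -> \bar R) : Prop :=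
  is_divergence d /\
  exists C : R, 0 < C /\
    forall nu nu' : probability R R, on01 nu -> on01 nu' ->
    forall tau f g, hellinger_witness nu nu' tau f g ->
      (1%:E - hellinger_value tau f g <= C%:E * d nu nu')%E.

Definition cylinder (n : nat) (A : nat -> set R) : set (nat -> R) :=
  [set x | forall i, (i < n)%N -> A i (x i)].

Definition cylinders : set (set (nat -> R)) :=
  [set C | exists n (A : nat -> set R),
     (forall i, (i < n)%N -> measurable (A i)) /\ C = cylinder n A].

End Defs.

Notation seqspace R := (g_sigma_algebraType (@cylinders R)).

Section Defs2.
Variable R : realType.

Definition is_product_measure (mu : probability (seqspace R) R)
  (nu : nat -> probability R R) : Prop :=
  forall n (A : nat -> set R), (forall i, (i < n)%N -> measurable (A i)) ->
    mu (cylinder n A : set (seqspace R)) = (\prod_(i < n) nu i (A i))%E.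

(* b-biased measure; nu : nat -> _ is 0-indexed (nu i is nu_{i+1}) *)
Definition b_biased (b : R) (mu : probability (seqspace R) R) : Prop :=
  -(1/2) <= b <= 1/2 /\
  exists (nu : nat -> probability R R) (nu0 : probability R R)
         (d : probability R R -> probability R R -> \bar R),
    (forall n, on01 (nu n)) /\ on01 nu0 /\
    is_product_measure mu nu /\
    (forall n, nu n `<< nu0) /\
    (\int[nu0]_(x in (`[0%R, 1%R]%classic)) x%:E)%E = (1/2 + b)%:E /\
    classD d /\
    (\sum_(0 <= n <oo) d (nu n) nu0 < +oo)%E.

(* P(sum_{i<n} X_i > n/2) for independent Bernoulli(p_i), i = 0..n-1 *)
Definition maj_prob (p : nat -> R) (n : nat) : R :=
  \sum_(S : {set 'I_n} | (n < 2 * #|S|)%N)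
     \prod_(i < n) (if i \in S then p i else 1 - p i).

Definition CJP (p : nat -> R) : Prop :=
  (fun k : nat => maj_prob p k.*2.+1) @ \oo --> (1 : R).

Definition C_I : set (nat -> R) :=
  [set p | (forall i, 0 <= p i <= 1) /\ CJP p].

End Defs2.

(* Main.v *)
Require Import Defs.
From HB Require Import structures.
From mathcomp Require Import all_boot all_order all_algebra.
From mathcomp Require Import all_classical all_reals all_analysis.
From mathcomp Require Import measurable_realfun ring lra.
Import Order.TTheory GRing.Theory Num.Theory.
Import numFieldNormedType.Exports.
Local Open Scope classical_set_scope.
Local Open Scope ring_scope.

(* Summability of [d (nu n) nu0] forces the Hellinger integrals to tend to 1,
   hence the means of [nu n] are eventually at least 1/2 + b/2.  With
   u = 1 + b, the Chernoff bound gives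
     1 - maj_prob p n <= \prod_(i < n) (p i / u + (1 - p i) * u),
   and by independence the [mu]-expectation of the right-hand side is a product
   whose factors are eventually at most 1 - b^2/2 < 1.  The expectations are
   therefore summable, so the right-hand side tends to 0 almost surely. *)

(** * Integrals of a function of one variable against a weight *)

Section integral_comp_weight.
Import HBNNSimple.

(** The hypothesis on indicators says that the image under [X] of the measure with density [W] is
    [w] times [nu]. Simple functions follow by linearity, and nonnegative measurable functions by
    monotone convergence. *)
Lemma ge0_integral_comp_weight (d d' : measure_display)
    (T : measurableType d) (T' : measurableType d')
    (R : realType) (mu : {measure set T -> \bar R})
    (nu : {measure set T' -> \bar R}) (X : T -> T') (W : T -> R) (w : R) :
  measurable_fun setT X -> measurable_fun setT W -> (forall t, 0 <= W t) ->
  0 <= w ->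
  (forall A : set T', measurable A ->
    (\int[mu]_t (\1_A (X t) * W t)%:E = w%:E * nu A)%E) ->
  forall f : T' -> R, measurable_fun setT f -> (forall x, 0 <= f x) ->
  (\int[mu]_t (f (X t) * W t)%:E = w%:E * \int[nu]_x (f x)%:E)%E.
Proof.
move=> mX mW W0 w0 muXW f mf f0.
have mEf : measurable_fun setT (EFin \o f) by exact/measurable_EFinP.
pose h := nnsfun_approx measurableT mEf.
have f0E x : setT x -> (0 <= (EFin \o f) x)%E by move=> _; rewrite lee_fin.
have ch x : (h n x)%:E @[n --> \oo] --> (f x)%:E.
  exact: (@cvg_nnsfun_approx _ _ _ _ measurableT _ mEf f0E x).
have ndh x (a c : nat) : (a <= c)%N -> h a x <= h c x.
  by move=> ac; exact/lefP/nd_nnsfun_approx.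
have h0 n x : 0 <= h n x by exact: fun_ge0.
have mhX n : measurable_fun setT (fun t => h n (X t)).
  by apply: (measurableT_comp _ mX).
have mhXW n : measurable_fun setT (fun t => (h n (X t) * W t)%:E).
  by apply/measurable_EFinP; exact: measurable_funM.
have -> : (\int[nu]_x (f x)%:E = lim (\int[nu]_x (h n x)%:E @[n --> \oo]))%E.
  under eq_integral => x _ do rewrite -(cvg_lim _ (ch x))//.
  apply: monotone_convergence => //.
  - by move=> n; apply/measurable_EFinP.
  - by move=> n x _; rewrite lee_fin.
  - by move=> x _ a c ac; rewrite lee_fin; exact: ndh.
have -> : (\int[mu]_t (f (X t) * W t)%:E =
    lim (\int[mu]_t (h n (X t) * W t)%:E @[n --> \oo]))%E.
  have fW t : (f (X t) * W t)%:E = lim ((h n (X t) * W t)%:E @[n --> \oo])%E.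
    apply/esym/cvg_lim => //; rewrite EFinM.
    under eq_fun do rewrite EFinM.
    by apply: cvgeZr => //; exact: ch.
  under eq_integral => t _ do rewrite fW.
  apply: monotone_convergence => //.
  - by move=> n t _; rewrite lee_fin mulr_ge0.
  - by move=> t _ a c ac; rewrite lee_fin ler_wpM2r// ndh.
rewrite -limeMl//; last first.
  apply: ereal_nondecreasing_is_cvgn => a c ac.
  apply: ge0_le_integral => //.
  - by move=> x _; rewrite lee_fin.
  - exact/measurable_EFinP.
  - exact/measurable_EFinP.
  - by move=> x _; rewrite lee_fin ndh.
apply: congr_lim; apply/funext => n /=.
have hE x : (h n x)%:E = (\sum_(y \in range (h n)) (y * \1_(h n @^-1` [set y]) x)%:E)%E.
  by rewrite fimfunE -fsumEFin.
have mI y : measurable (h n @^-1` [set y]) by exact: measurable_sfunP.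
have mIX y : measurable_fun setT (fun t => (\1_(h n @^-1` [set y]) (X t) : R)).
  by apply: (measurableT_comp _ mX); exact: measurable_indic.
under [X in (_ = _ * X)%E]eq_integral => x _ do rewrite hE.
rewrite ge0_integral_fsum//; last 2 first.
  by move=> y; apply/measurable_EFinP; apply: measurable_funM => //; exact: measurable_indic.
  by move=> y x _; exact: nnfun_muleindic_ge0.
rewrite ge0_mule_fsumr; last first.
  by move=> y; apply: integral_ge0 => x _; exact: nnfun_muleindic_ge0.
transitivity (\int[mu]_t (\sum_(y \in range (h n))
    (y * (\1_(h n @^-1` [set y]) (X t) * W t))%:E))%E.
  apply: eq_integral => t _; rewrite EFinM hE ge0_mule_fsuml//; last first.
    by move=> y; exact: nnfun_muleindic_ge0.
  by apply: eq_fsbigr => y _; rewrite -EFinM mulrA.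
rewrite ge0_integral_fsum//; last 2 first.
  move=> y; apply/measurable_EFinP; apply: measurable_funM => //.
  exact: measurable_funM.
  move=> y t _; rewrite mulrA EFinM mule_ge0 ?lee_fin//.
  exact: nnfun_muleindic_ge0.
(* Writing [y] as a value [h n z] makes it nonnegative, as pulling it out of the integrals
   requires. *)
apply: eq_fsbigr => y; rewrite inE => -[z _ <-].
under eq_integral do rewrite EFinM.
under [X in (_ = _ * X)%E]eq_integral do rewrite EFinM.
have hz0 : (0 <= (h n z)%:E)%E by rewrite lee_fin.
have mIW : measurable_fun setT
    (fun t => (\1_(h n @^-1` [set h n z]) (X t) * W t)%:E).
  by apply/measurable_EFinP; exact: measurable_funM.
have IW0 t : (0 <= (\1_(h n @^-1` [set h n z]) (X t) * W t)%:E)%E.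
  by rewrite lee_fin mulr_ge0.
rewrite (ge0_integralZl _ _ mIW (fun t _ => IW0 t) hz0)// muXW//.
rewrite ge0_integralZl//; last exact/measurable_EFinP/measurable_indic.
by rewrite integral_indic// setIT muleCA.
Qed.

End integral_comp_weight.

(** * Coordinates of the sequence space and the product measure *)

Lemma measurable_coord (R : realType) (i : nat) :
  measurable_fun setT (fun p : seqspace R => (p : nat -> R) i).
Proof.
move=> _ A mA; rewrite setTI.
apply: sub_sigma_algebra; exists i.+1, (fun j => if j == i then A else setT).
split; first by move=> j _; case: ifP.
apply/seteqP; split => [p pA j _|p /(_ i (ltnSn i))]; rewrite ?eqxx//.
by case: ifP => // /eqP ->.
Qed.

Lemma measurable_prod_coord (R : realType) (n : nat) (P : pred 'I_n)
    (f : nat -> R -> R) : (forall i, measurable_fun setT (f i)) ->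
  measurable_fun setT
    (fun p : seqspace R => \prod_(i < n | P i) f i ((p : nat -> R) i)).
Proof.
move=> mf; under [X in measurable_fun _ X]eq_fun do rewrite big_mkcond.
apply: measurable_prod => i _; case: (P i); last exact: measurable_cst.
exact: (measurableT_comp (mf i) (measurable_coord R i)).
Qed.

Section product_measure.
Context {R : realType}.
Variables (mu : probability (seqspace R) R) (nu : nat -> probability R R).
Hypothesis muP : is_product_measure mu nu.

(* Hybrid argument: the coordinates are turned one at a time from indicator
   functions, where the formula is [muP], into arbitrary functions. *)
Let integral_prod_hybrid (n k : nat) : (k <= n)%N ->
  forall (f : nat -> R -> R) (I : nat -> R),
  (forall i, measurable_fun setT (f i)) -> (forall i x, 0 <= f i x) ->
  (forall i, \int[nu i]_x (f i x)%:E = (I i)%:E)%E ->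
  (forall i, (k <= i < n)%N -> exists2 A : set R, measurable A & f i = \1_A) ->
  (\int[mu]_p (\prod_(i < n) f i ((p : nat -> R) i))%:E =
   (\prod_(i < n) I i)%:E)%E.
Proof.
elim: k => [_|k IH kn] f I mf f0 fI find.
  (* Base case: every factor is an indicator, so the product is the indicator of a cylinder. Indices
     from [n] on get the dummy set [setT], so that [choice] applies to all of [nat]. *)
  have {}find i : exists A : set R, (i < n)%N -> measurable A /\ f i = \1_A.
    have [lt_in|_] := ltnP i n; last by exists setT.
    by have [A mA fA] := find i lt_in; exists A.
  have [A fA] := choice find.
  have mA i : (i < n)%N -> measurable (A i) by move=> /fA[].
  under eq_integral => p _.
    rewrite (_ : \prod_(i < n) _ = \1_(cylinder n A : set (seqspace R)) p).
      over.
    rewrite indicE; have [pA|npA] := boolP (p \in _).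
      rewrite inE in pA; rewrite big1// => i _.
      by have [_ ->] := fA i (ltn_ord i); rewrite indicE mem_set//; exact: pA.
    have [i [lt_in Npi]] : exists i, (i < n)%N /\ ~ A i ((p : nat -> R) i).
      apply: contrapT => H; move/negP: npA; apply; rewrite inE => i lt_in.
      by apply: contrapT => Npi; apply: H; exists i.
    rewrite (bigD1 (Ordinal lt_in))//=.
    by have [_ ->] := fA i lt_in; rewrite indicE memNset ?mul0r.
  rewrite integral_indic//; last first.
    by apply: sub_sigma_algebra; exists n, A.
  rewrite setIT; apply: etrans (muP n A mA) _.
  rewrite -prodEFin; apply: eq_bigr => i _.
  rewrite -fI; have [mAi ->] := fA i (ltn_ord i).
  by rewrite integral_indic// setIT.
(* Coordinate [k] is the one that becomes arbitrary; [W] gathers all the others as a weight. *)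
pose k' := Ordinal kn.
pose W := fun p : seqspace R => \prod_(i < n | i != k') f i ((p : nat -> R) i).
pose w := \prod_(i < n | i != k') I i.
have I0 i : 0 <= I i by rewrite -lee_fin -fI integral_ge0// => x _; rewrite lee_fin.
under eq_integral => p _ do rewrite (bigD1 k')//= -/(W p).
rewrite (bigD1 k')//= -/w mulrC EFinM -fI.
apply: (@ge0_integral_comp_weight _ _ _ _ _ mu (nu k)
   (fun p : seqspace R => (p : nat -> R) k) W w) => //.
- exact: measurable_coord.
- exact: measurable_prod_coord.
- by move=> p; exact: prodr_ge0.
- exact: prodr_ge0.
move=> A mA.
(* Testing coordinate [k] on an indicator restores the hypothesis of the induction: [f'] consists of
   indicators from [k] on. *)
pose f' i := if i == k then \1_A : R -> R else f i.
pose I' i := if i == k then fine (nu k A) else I i.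
have WE p : \1_A ((p : nat -> R) k) * W p =
    \prod_(i < n) f' i ((p : nat -> R) i).
  rewrite (bigD1 k')//= {1}/f' eqxx; congr (_ * _).
  by apply: eq_bigr => i ik; rewrite /f' (negbTE (ik : val i != k)).
have wE : (w%:E * nu k A)%E = (\prod_(i < n) I' i)%:E.
  rewrite (bigD1 k')//= {1}/I' eqxx mulrC EFinM fineK ?fin_num_measure//.
  congr ((_)%:E * _)%E.
  by apply: eq_bigr => i ik; rewrite /I' (negbTE (ik : val i != k)).
rewrite wE; under eq_integral => p _ do rewrite WE.
apply: (IH (ltnW kn) f' I').
- by move=> i; rewrite /f'; case: ifP => // _; exact: measurable_indic.
- by move=> i x; rewrite /f'; case: ifP.
- move=> i; rewrite /f' /I'; case: ifP => // /eqP ->.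
  by rewrite integral_indic// setIT fineK ?fin_num_measure.
- move=> i /andP[ki lt_in]; rewrite /f'; case: ifP => [_|ik]; first by exists A.
  by apply: find; rewrite lt_in ltn_neqAle eq_sym ik ki.
Qed.

Lemma integral_prod_coord (n : nat) (f : nat -> R -> R) (I : nat -> R) :
  (forall i, measurable_fun setT (f i)) -> (forall i x, 0 <= f i x) ->
  (forall i, \int[nu i]_x (f i x)%:E = (I i)%:E)%E ->
  (\int[mu]_p (\prod_(i < n) f i ((p : nat -> R) i))%:E =
   (\prod_(i < n) I i)%:E)%E.
Proof.
move=> mf f0 fI; apply: (integral_prod_hybrid _ _ (leqnn n)) => // i /andP[ni].
by rewrite ltnNge ni.
Qed.

(** The sequence space is built over the whole line, whereas [C_I] requires entries in [0,1]. Each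
    coordinate constraint is a cylinder of measure 1, and there are countably many of them. *)
Lemma ae_coord_in01 : (forall i, on01 (nu i)) ->
  {ae mu, forall p : seqspace R, forall i, 0 <= (p : nat -> R) i <= 1}.
Proof.
move=> nu01; apply: ae_foralln => i.
pose C : set (seqspace R) :=
  (fun p : seqspace R => (p : nat -> R) i) @^-1` (`[0, 1]%classic).
have mC : measurable C by rewrite -[C]setTI; apply: measurable_coord.
exists (~` C); split; first exact: measurableC.
- suff muC : mu C = 1%E by apply: etrans (probability_setC mu mC) _; rewrite muC subee.
  pose A j : set R := if j == i then `[0, 1]%classic else setT.
  have -> : C = cylinder i.+1 A.
    apply/seteqP; rewrite /A; split => [p pA j _|p /(_ i (ltnSn i))];
      rewrite ?eqxx//.
    by case: ifP => // /eqP ->.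
  rewrite (muP i.+1 A); last by move=> j _; rewrite /A; case: ifP.
  rewrite big1// => j _; rewrite /A; case: ifP => [/eqP ->|_].
    exact: nu01.
  exact: probability_setT.
- by move=> p /= + Cp; apply; move: Cp; rewrite /C /= in_itv.
Qed.

End product_measure.

(** * Chernoff bound for the majority probability *)

(** Taken at [p i] and [1 - p i], this gives total mass 1 to the outcomes [S]; taken at the weighted
    terms, it expands the Chernoff product over the same outcomes. *)
Lemma prod_addr_set (R : comPzRingType) (I : finType) (F G : I -> R) :
  \prod_i (F i + G i) =
  \sum_(S : {set I}) \prod_i (if i \in S then F i else G i).
Proof. by rewrite bigA_distr; apply: eq_bigl. Qed.

Lemma maj_prob_le1 (R : realType) (p : nat -> R) (n : nat) :
  (forall i, 0 <= p i <= 1) -> maj_prob p n <= 1.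
Proof.
move=> p01.
have -> : 1 = \sum_(S : {set 'I_n})
    \prod_(i < n) (if i \in S then p i else 1 - p i).
  by rewrite -prod_addr_set big1// => i _; rewrite addrC subrK.
rewrite /maj_prob big_mkcond/=.
apply: ler_sum => S _; case: ifP => // _.
by apply: prodr_ge0 => i _; case: ifP => _; have /andP[] := p01 i; lra.
Qed.

(* Markov's inequality for u^(n - 2 |S|) under the product law. *)
Lemma maj_prob_chernoff (R : realType) (p : nat -> R) (u : R) (n : nat) :
  1 <= u -> (forall i, 0 <= p i <= 1) ->
  1 - maj_prob p n <= \prod_(i < n) (p i / u + (1 - p i) * u).
Proof.
move=> u1 p01.
have u0 : 0 < u by exact: lt_le_trans u1.
pose q (S : {set 'I_n}) := \prod_(i < n) (if i \in S then p i else 1 - p i).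
have q0 S : 0 <= q S.
  by apply: prodr_ge0 => i _; case: ifP => _; have /andP[] := p01 i; lra.
have {1}-> : 1 = \sum_S q S.
  by rewrite -prod_addr_set big1// => i _; rewrite addrC subrK.
rewrite prod_addr_set /maj_prob [X in _ - X]big_mkcond/= -sumrB.
apply: ler_sum => S _; rewrite -/(q S).
have -> : \prod_(i < n) (if i \in S then p i / u else (1 - p i) * u) =
    q S * (u ^- #|S| * u ^+ (n - #|S|)).
  have -> : u ^- #|S| * u ^+ (n - #|S|) =
      \prod_(i < n) (if i \in S then u^-1 else u).
    rewrite (bigID (mem S))/= -exprVn; congr (_ * _).
      by under eq_bigr => i -> do []; rewrite prodr_const.
    under eq_bigr => i /negbTE -> do []; rewrite prodr_const.
    have /(congr1 (subn^~ #|S|)) := cardC (mem S); rewrite addKn card_ord.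
    by move=> <-; congr (_ ^+ _); apply: eq_card.
  by rewrite -big_split/=; apply: eq_bigr => i _; case: ifP.
(* A majority outcome contributes 0 on the left. Otherwise [2 * #|S| <= n], so the weight of [S] is
   a nonnegative power of [u], hence at least 1. *)
case: ifP => [_|/negbT]; first by rewrite subrr mulr_ge0// mulr_ge0// ?invr_ge0 exprn_ge0// ltW.
rewrite -leqNgt mul2n -addnn => Sn; rewrite subr0 ler_peMr//.
rewrite mulrC ler_pdivlMr ?exprn_gt0// mul1r ler_weXn2l//.
by rewrite leq_subRL// (leq_trans (leq_addl _ _) Sn).
Qed.

(** * From summable divergences to convergence of the means *)

(** Each term is at most the tail of the series starting at it, and the tails of a finite sum tend
    to 0. *)
Lemma nneseries_cvg0 (R : realType) (u : nat -> \bar R) :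
  (forall n, 0 <= u n)%E -> (\sum_(0 <= n <oo) u n < +oo)%E ->
  u @ \oo --> 0%E.
Proof.
move=> u0 su.
apply: (@squeeze_cvge _ _ _ _ (cst 0%E) _ (fun N => \sum_(N <= k <oo) u k)%E).
- apply: nearW => N; rewrite u0/=.
  have := @nneseries_lim_ge _ u xpredT N N.+1 (fun n _ _ => u0 n).
  by rewrite big_nat1.
- exact: cvg_cst.
- exact: nneseries_tail_cvg.
Qed.

Section mean_hellinger.
Context {R : realType}.
Local Notation D := (`[0%R, 1%R]%classic : set R).

Definition mean01 (nu : probability R R) : R := fine (\int[nu]_(x in D) x%:E)%E.

Lemma mean01E (nu : probability R R) : on01 nu ->
  (\int[nu]_(x in D) x%:E)%E = (mean01 nu)%:E.
Proof.
move=> nu01; rewrite /mean01 fineK// ge0_fin_numE; last first.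
  by apply: integral_ge0 => x /=; rewrite in_itv/= lee_fin => /andP[].
apply: (@le_lt_trans _ _ (\int[nu]_(x in D) (cst 1%E) x)%E).
  apply: ge0_le_integral => //.
  - by move=> x /=; rewrite in_itv/= lee_fin => /andP[].
  - by move=> x /=; rewrite in_itv/= lee_fin => /andP[].
by rewrite integral_cst// mul1e [X in (X < _)%E]nu01 ltry.
Qed.

(* Integrated against [nu0] with s the square root of the density, this
   compares the means through the Hellinger integral. *)
Let mean_gap_le (e x s : R) : 0 < e -> 0 <= x <= 1 -> 0 <= s ->
  x + 2 / e * s <= x * s ^+ 2 + (e + e^-1 + e^-1 * s ^+ 2).
Proof.
move=> e0 /andP[x0 x1] s0.
have e0' := ltW e0; have ei0 : 0 <= e^-1 by rewrite invr_ge0.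
have AG : 2 * (1 - s) <= e + e^-1 * (1 - s) ^+ 2.
  rewrite -subr_ge0.
  have -> : e + e^-1 * (1 - s) ^+ 2 - 2 * (1 - s) = e^-1 * (e - (1 - s)) ^+ 2.
    by field; rewrite gt_eqF.
  by rewrite mulr_ge0 ?sqr_ge0.
have xs : x * (1 - s ^+ 2) <= e + e^-1 * (1 - s) ^+ 2.
  (* For [s <= 1], the left side is at most [1 - s ^+ 2 <= 2 * (1 - s)], and [AG] applies. For
     [s > 1] it is nonpositive. *)
  have [s1|s1] := leP s 1.
    apply: le_trans AG; apply: (@le_trans _ _ (1 - s ^+ 2)).
      by rewrite ler_piMl// subr_ge0 expr_le1.
    rewrite -subr_ge0 (_ : _ - _ = (1 - s) ^+ 2) ?sqr_ge0//; ring.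
  apply: (@le_trans _ _ 0).
    by rewrite mulr_ge0_le0// subr_le0 exprn_ege1// ltW.
  by rewrite addr_ge0// mulr_ge0 ?sqr_ge0.
rewrite -subr_ge0; move: xs; rewrite -subr_ge0; congr (_ <= _).
by field; rewrite gt_eqF.
Qed.

(** The reference measure is [nu0] itself, with densities dnu/dnu0 and 1, so [H] is the integral of
    the square root of dnu/dnu0. The free parameter [e] linearizes a bound of order sqrt(1 - H). *)
Lemma mean01_hellinger (nu nu0 : probability R R) :
  on01 nu -> on01 nu0 -> nu `<< nu0 ->
  exists f g H, [/\ hellinger_witness nu nu0 nu0 f g,
    hellinger_value nu0 f g = H%:E &
    forall e : R, 0 < e -> mean01 nu0 - mean01 nu <= e + 2 / e * (1 - H)].
Proof.
move=> nu01 nu001 dom.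
pose F := Radon_Nikodym_SigmaFinite.f nu nu0.
have F0 : forall x, (0 <= F x)%E by exact: Radon_Nikodym_SigmaFinite.f_ge0.
have Ffin : forall x, F x \is a fin_num by exact: Radon_Nikodym_SigmaFinite.f_fin_num.
pose f x := fine (F x).
have fE x : (f x)%:E = F x by rewrite fineK.
have f0 x : 0 <= f x by exact: fine_ge0.
have mF : measurable_fun setT F.
  exact: measurable_int (Radon_Nikodym_SigmaFinite.f_integrable dom).
have mf : measurable_fun setT f.
  by apply/measurable_EFinP; rewrite (_ : _ \o _ = F)//; apply/funext => x /=.
pose g : R -> R := cst 1.
pose s x := Num.sqrt (f x).
have s0 x : 0 <= s x by exact: sqrtr_ge0.
have ms : measurable_fun setT s.
  apply: (measurableT_comp _ mf); apply: continuous_measurable_fun.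
  exact: sqrt_continuous.
have sf x : s x ^+ 2 = f x by rewrite sqr_sqrtr.
have intf A : measurable A -> nu A = (\int[nu0]_(x in A) (f x)%:E)%E.
  move=> mA; under eq_integral do rewrite fE.
  exact: Radon_Nikodym_SigmaFinite.f_integral.
(* This integrates [mean_gap_le] over [0,1]; since [f] has integral 1, the last terms give
   [e + 2 / e]. The additive form avoids subtracting a Hellinger integral not yet known to be
   finite. *)
have main (e : R) : 0 < e -> ((mean01 nu0)%:E + (2 / e)%:E * hellinger_value nu0 f g
    <= (mean01 nu)%:E + (e + 2 / e)%:E)%E.
  move=> e0; have e0' := ltW e0; have ei0 : 0 <= e^-1 by rewrite invr_ge0.
  have e20 : 0 <= 2 / e by rewrite mulr_ge0.
  have mD : measurable D by [].
  have x0 x : D x -> (0 <= x%:E)%E by rewrite /= in_itv/= lee_fin => /andP[].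
  have mx : measurable_fun D (fun x : R => x%:E) by apply/measurable_EFinP; exact: measurable_funTS.
  have msE : measurable_fun D (fun x : R => (s x)%:E) by apply/measurable_EFinP; exact: measurable_funTS.
  have mfE : measurable_fun D (fun x : R => (f x)%:E) by apply/measurable_EFinP; exact: measurable_funTS.
  have -> : hellinger_value nu0 f g = (\int[nu0]_(x in D) (s x)%:E)%E.
    by apply: eq_integral => x _; rewrite /g /= mulr1.
  have -> : (e + 2 / e)%:E = (\int[nu0]_(x in D) ((e + e^-1)%:E + e^-1%:E * (f x)%:E))%E.
    rewrite ge0_integralD//; last 3 first.
    - by move=> x _; rewrite lee_fin addr_ge0.
    - by move=> x _; rewrite -EFinM lee_fin mulr_ge0.
    - exact: measurable_funeM.
    rewrite (integral_cst nu0 mD) [X in (_ * X + _)%E]nu001.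
    rewrite ge0_integralZl//; last by move=> x _; rewrite lee_fin.
    rewrite -intf// [X in (_ * _ + _ * X)%E]nu01 !mule1 -EFinD; congr EFin.
    by rewrite -addrA -mulr2n mulr_natl.
  rewrite -!mean01E//.
  have -> : (\int[nu]_(x in D) x%:E = \int[nu0]_(x in D) (x * f x)%:E)%E.
    (* The change of variables is applied to a function nonnegative on the whole line, hence the
       absolute value. *)
    have -> : (\int[nu]_(x in D) x%:E = \int[nu]_(x in D) (`|x|)%:E)%E.
      apply: eq_integral => x; rewrite inE => /x0; rewrite lee_fin => xx.
      by rewrite ger0_norm.
    have mabs : measurable_fun D (fun x : R => (`|x|)%:E).
      apply/measurable_EFinP; apply: measurable_funTS.
      exact: (measurableT_comp (@normr_measurable R setT)).
    have abs0 (x : R) : (0 <= (`|x|)%:E)%E by rewrite lee_fin.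
    rewrite -(Radon_Nikodym_SigmaFinite.change_of_variables dom abs0 mD mabs).
    apply: eq_integral => x; rewrite inE => /x0; rewrite lee_fin => xx.
    by rewrite ger0_norm// -/F -fE.
  have ms2 : measurable_fun D (fun x => ((2 / e)%:E * (s x)%:E)%E) by exact: measurable_funeM.
  have mf2 : measurable_fun D (fun x => ((e + e^-1)%:E + e^-1%:E * (f x)%:E)%E).
    by apply: emeasurable_funD => //; exact: measurable_funeM.
  have mxf : measurable_fun D (fun x => (x * f x)%:E).
    by apply/measurable_EFinP/measurable_funTS; exact: measurable_funM.
  have f20 x : D x -> (0 <= (e + e^-1)%:E + e^-1%:E * (f x)%:E)%E.
    by move=> _; rewrite -EFinM -EFinD lee_fin !addr_ge0// mulr_ge0.
  have s20 x : D x -> (0 <= (2 / e)%:E * (s x)%:E)%E.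
    by move=> _; rewrite -EFinM lee_fin mulr_ge0.
  have xf0 x : D x -> (0 <= (x * f x)%:E)%E.
    by move=> /x0; rewrite !lee_fin => xx; rewrite mulr_ge0.
  rewrite -ge0_integralZl//; last by move=> x _; rewrite lee_fin.
  rewrite -ge0_integralD// -ge0_integralD//; apply: ge0_le_integral => //.
  - by move=> x Dx; rewrite adde_ge0// ?s20// x0.
  - exact: emeasurable_funD.
  - exact: emeasurable_funD.
  move=> x; rewrite /= in_itv/= => x01.
  by rewrite -!EFinM -!EFinD lee_fin -sf mean_gap_le.
(* An infinite value would make the left side of [main] infinite at [e = 1]. *)
have Hfin : hellinger_value nu0 f g \is a fin_num.
  have H0 : (0 <= hellinger_value nu0 f g)%E.
    by apply: integral_ge0 => x _; rewrite lee_fin sqrtr_ge0.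
  rewrite ge0_fin_numE//; have := main 1 ltr01.
  by case: (hellinger_value _ _ _) H0 => [r _ _||]//=; rewrite ?ltry// divr1 gt0_muley ?lte_fin.
exists f, g, (fine (hellinger_value nu0 f g)); split.
- split => //; split; first exact: measurable_cst.
  split => //; split; first by move=> x; exact: ler01.
  move=> A mA _; split; first exact: intf.
  by rewrite [RHS](integral_cst nu0 mA 1%E) mul1e.
- by rewrite fineK.
- move=> e e0; have := main e e0; rewrite -(fineK Hfin) -EFinM -!EFinD lee_fin /=.
  by lra.
Qed.

Lemma mean01_classD (d : probability R R -> probability R R -> \bar R)
    (nu : nat -> probability R R) (nu0 : probability R R) :
  (forall n, on01 (nu n)) -> on01 nu0 -> (forall n, nu n `<< nu0) ->
  classD d -> (\sum_(0 <= n <oo) d (nu n) nu0 < +oo)%E ->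
  forall e : R, 0 < e -> \forall n \near \oo, mean01 nu0 - e <= mean01 (nu n).
Proof.
move=> nu01 nu001 dom [ddiv [C [C0 dC]]] sd e e0.
have d0 n : (0 <= d (nu n) nu0)%E by have [] := ddiv (nu n) nu0 (nu01 n) nu001.
have cd := nneseries_cvg0 _ _ d0 sd.
have e20 : 0 < e / 2 by rewrite divr_gt0.
(* [mean01_hellinger] will be used at [e / 2]; [del] makes its second term, with [1 - H <= C * del],
   at most the other [e / 2]. *)
pose del := (e / 2) ^+ 2 / 2 / C.
have del0 : 0 < del by rewrite !divr_gt0// exprn_gt0.
have : \forall n \near \oo, (d (nu n) nu0 < del%:E)%E.
  have : nbhs (0%E : \bar R) [set y | (y < del%:E)%E].
    by apply: open_ereal_lt'; rewrite lte_fin.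
  exact: cd.
apply: filterS => n dn.
have [f [g [H [wit HE mH]]]] := mean01_hellinger _ _ (nu01 n) nu001 (dom n).
have := dC _ _ (nu01 n) nu001 _ _ _ wit; rewrite HE => H1.
have {}H1 : 1 - H <= C * del.
  rewrite -lee_fin EFinB EFinM; apply: (le_trans H1).
  by rewrite lee_pmul2l// ltW.
have := mH _ e20.
have : 2 / (e / 2) * (1 - H) <= 2 / (e / 2) * (C * del).
  by rewrite ler_wpM2l// divr_ge0// ltW.
have -> : 2 / (e / 2) * (C * del) = e / 2.
  by rewrite /del; field; rewrite !gt_eqF.
lra.
Qed.

End mean_hellinger.

(** * Expectation of one Chernoff factor *)

Section chernoff_factor.
Context {R : realType}.
Local Notation D := (`[0%R, 1%R]%classic : set R).

(* The indicator makes the factor nonnegative on the whole line. *)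
Definition chernoff_factor (u x : R) : R := (x / u + (1 - x) * u) * \1_D x.

Lemma chernoff_factor_ge0 (u x : R) : 0 <= u -> 0 <= chernoff_factor u x.
Proof.
move=> u0; rewrite /chernoff_factor indicE.
have [|_] := boolP (x \in D); last by rewrite mulr0.
rewrite inE/= in_itv/= => /andP[x0 x1].
by rewrite mulr1 addr_ge0// mulr_ge0// ?invr_ge0// subr_ge0.
Qed.

Lemma measurable_chernoff_factor (u : R) :
  measurable_fun setT (chernoff_factor u).
Proof.
apply: measurable_funM; last exact: measurable_indic.
apply: measurable_funD; first exact: measurable_funM.
by apply: measurable_funM => //; exact: measurable_funB.
Qed.

(** On [0,1] the factor is the affine function [u - (u - u^-1) * x], so only the mean of [nu]
    matters. *)
Lemma integral_chernoff_factor (nu : probability R R) (u : R) :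
  on01 nu -> 1 <= u ->
  (\int[nu]_x (chernoff_factor u x)%:E =
   (u - (u - u^-1) * mean01 nu)%:E)%E.
Proof.
move=> nu01 u1; have u0 : 0 < u by exact: lt_le_trans u1.
have u0' := ltW u0.
have c0 : 0 <= u - u^-1.
  by rewrite subr_ge0 (le_trans _ u1)// invf_le1.
have mD : measurable D by [].
have mx : measurable_fun D (fun x : R => x%:E).
  by apply/measurable_EFinP; exact: measurable_funTS.
have x0 x : D x -> (0 <= x%:E)%E by rewrite /= in_itv/= lee_fin => /andP[].
have intD : (\int[nu]_x (chernoff_factor u x)%:E =
    \int[nu]_(x in D) (chernoff_factor u x)%:E)%E.
  rewrite [RHS]integral_mkcond; apply: eq_integral => x _.
  rewrite patchE; case: ifPn => // xD.
  by rewrite /chernoff_factor indicE (negbTE xD) mulr0.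
(* Moving the linear term to the left leaves only nonnegative integrands, whose integrals add
   without integrability conditions. *)
have total : (\int[nu]_x (chernoff_factor u x)%:E +
    ((u - u^-1) * mean01 nu)%:E = u%:E)%E.
  rewrite intD EFinM -mean01E// -ge0_integralZl// -ge0_integralD//.
  - rewrite -[RHS]mule1 -nu01 -(integral_cst nu mD u%:E).
    apply: eq_integral => x xD; rewrite /chernoff_factor indicE xD mulr1.
    by rewrite -EFinM -EFinD; congr EFin; rewrite /=; field; rewrite gt_eqF.
  - by move=> x _; rewrite lee_fin chernoff_factor_ge0.
  - apply/measurable_EFinP/measurable_funTS; exact: measurable_chernoff_factor.
  - by move=> x Dx; rewrite mule_ge0 ?lee_fin// -lee_fin x0.
  - exact: measurable_funeM.
move: total; case: (\int[nu]_x _)%E => [r||]//= [ru].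
by congr EFin; apply/eqP; rewrite eq_sym subr_eq ru.
Qed.

End chernoff_factor.

(** * Geometric decay of the expectations and almost sure convergence *)

(** The first [N] factors are bounded by [u] and the later ones by [r]. The exponent [minn n N]
    counts the early factors already met, which lets the induction cover [n < N] too. *)
Lemma prod_eventually_le (R : realType) (I : nat -> R) (u r : R) (N : nat) :
  0 < r -> 0 <= u -> (forall i, 0 <= I i <= u) ->
  (forall i, (N <= i)%N -> I i <= r) ->
  forall n, \prod_(i < n) I i <= (u / r) ^+ minn n N * r ^+ n.
Proof.
move=> r0 u0 Iu Ir; elim=> [|n IH]; first by rewrite big_ord0 min0n mulr1.
have P0 : 0 <= \prod_(i < n) I i by apply: prodr_ge0 => i _; have /andP[] := Iu i.
have /andP[In0 Inu] := Iu n.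
rewrite big_ord_recr/= exprSr; have [Nn|nN] := leqP N n.
  rewrite (minn_idPr (leqW Nn)) -(minn_idPr Nn) mulrA.
  by apply: ler_pM => //; exact: Ir.
rewrite (minn_idPl nN) exprSr; rewrite (minn_idPl (ltnW nN)) in IH.
by rewrite mulrACA divfK ?gt_eqF// ler_pM.
Qed.

Lemma nneseries_geometric_lty (R : realType) (a r : R) :
  0 <= a -> 0 < r < 1 -> (\sum_(0 <= n <oo) (a * r ^+ n)%:E < +oo)%E.
Proof.
move=> a0 /andP[r0 r1]; apply: (@le_lt_trans _ _ (a / (1 - r))%:E); last exact: ltry.
apply: lime_le.
  by apply: is_cvg_nneseries => n _ _; rewrite lee_fin mulr_ge0// exprn_ge0// ltW.
apply: nearW => n; rewrite sumEFin lee_fin.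
by apply: geometric_le_lim => //; rewrite gtr0_norm.
Qed.

Theorem theorem2 (R : realType) (b : R) (mu : probability (seqspace R) R) :
  0 < b -> b_biased b mu ->
  {ae mu, forall p : seqspace R, C_I p}.
Proof.
move=> b0 [/andP[_ b12] [nu [nu0 [d [nu01 [nu001 [muP [dom [m0 [dD sd]]]]]]]]]].
(* A mean of [1 / 2 + b / 2], that is [u / 2], gives the expected factor [u - (u ^+ 2 - 1) / 2],
   which is exactly [r]. *)
pose u := 1 + b; pose r := 1 - b ^+ 2 / 2.
have u1 : 1 <= u by rewrite /u; lra.
have u0 : 0 <= u by exact: le_trans u1.
have r01 : 0 < r < 1 by rewrite /r; apply/andP; split; nra.
have /andP[r0 r1] := r01.
pose I i := u - (u - u^-1) * mean01 (nu i).
have EI i : (\int[nu i]_x (chernoff_factor u x)%:E = (I i)%:E)%E.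
  exact: integral_chernoff_factor.
have c0 : 0 <= u - u^-1.
  by rewrite subr_ge0 (le_trans _ u1)// invf_le1// (lt_le_trans _ u1).
have I0 i : 0 <= I i.
  rewrite -lee_fin -EI; apply: integral_ge0 => x _.
  by rewrite lee_fin chernoff_factor_ge0.
have Iu i : 0 <= I i <= u.
  rewrite I0 /I lerBlDr lerDl mulr_ge0// -lee_fin -mean01E//.
  by apply: integral_ge0 => x /=; rewrite in_itv/= lee_fin => /andP[].
have [N _ HN] : \forall n \near \oo, mean01 nu0 - b / 2 <= mean01 (nu n).
  by apply: mean01_classD dD sd _ _ => //; rewrite divr_gt0.
have Ir i : (N <= i)%N -> I i <= r.
  move=> /HN /=; have -> : mean01 nu0 = 1 / 2 + b.
    by apply: EFin_inj; rewrite -mean01E.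
  move=> mi; rewrite /I.
  have : (u - u^-1) * (u / 2) <= (u - u^-1) * mean01 (nu i).
    by rewrite ler_wpM2l// (le_trans _ mi)// /u; lra.
  have -> : (u - u^-1) * (u / 2) = (u ^+ 2 - 1) / 2.
    by field; rewrite gt_eqF// (lt_le_trans _ u1).
  by rewrite /r /u; nra.
pose V n (p : seqspace R) := \prod_(i < n) chernoff_factor u ((p : nat -> R) i).
have V0 n p : 0 <= V n p by apply: prodr_ge0 => i _; exact: chernoff_factor_ge0.
have mV n : measurable_fun setT (fun p => (V n p)%:E).
  apply/measurable_EFinP.
  apply: (measurable_prod_coord R n xpredT (fun=> chernoff_factor u)) => _.
  exact: measurable_chernoff_factor.
have EV n : (\int[mu]_p (V n p)%:E = (\prod_(i < n) I i)%:E)%E.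
  apply: (integral_prod_coord mu nu muP n (fun=> chernoff_factor u) I) => //.
  - by move=> _; exact: measurable_chernoff_factor.
  - by move=> _ x; exact: chernoff_factor_ge0.
pose K := (u / r) ^+ N.
(* This allows the exponent [minn n N] to be raised to [N], giving a constant [K] independent of
   [n]. *)
have ur1 : 1 <= u / r by rewrite ler_pdivlMr// mul1r (le_trans (ltW r1)).
have K0 : 0 <= K by rewrite exprn_ge0// (le_trans ler01).
have VK n : \prod_(i < n) I i <= K * r ^+ n.
  apply: (le_trans (prod_eventually_le _ _ u r N r0 u0 Iu Ir n)).
  by rewrite ler_wpM2r ?exprn_ge0 ?(ltW r0)// ler_weXn2l// geq_minr.
(* The sum of the [V n] has finite expectation by comparison with a geometric series. It is
   therefore finite almost everywhere, which forces [V n p] to tend to 0. *)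
have sV : mu.-integrable setT (fun p => \sum_(0 <= n <oo) (V n p)%:E)%E.
  apply/integrableP; split.
    by apply: (@ge0_emeasurable_sum _ _ _ _ (fun n p => (V n p)%:E) xpredT) => *; rewrite ?lee_fin.
  under eq_integral => p _.
    rewrite gee0_abs; last by apply: nneseries_ge0 => n _ _; rewrite lee_fin.
    over.
  rewrite integral_nneseries//; last by move=> n p _; rewrite lee_fin.
  apply: le_lt_trans (nneseries_geometric_lty _ _ _ K0 r01).
  apply: lee_nneseries => [n _ _|n _]; first by rewrite EV lee_fin prodr_ge0.
  by rewrite EV lee_fin.
have := integrable_ae measurableT sV.
have := ae_coord_in01 mu nu muP nu01.
apply: filterS2 => p p01 /(_ Logic.I) sVp.
split=> //.
have {sVp}cV : V n p @[n --> \oo] --> 0.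
  have Vp0 n : (0 <= (V n p)%:E)%E by rewrite lee_fin.
  apply: (@fine_cvg _ _ _ _ (fun n => (V n p)%:E)); apply: nneseries_cvg0 => //.
  by rewrite -ge0_fin_numE// nneseries_ge0.
rewrite /CJP.
apply: (@squeeze_cvgr _ _ _ _ (fun k => 1 - V k.*2.+1 p) (cst 1)).
- apply: nearW => k; rewrite maj_prob_le1// andbT lerBlDr -lerBlDl.
  apply: (le_trans (maj_prob_chernoff _ _ u _ u1 p01)).
  apply: ler_prod => i _; have /andP[p0 p1] := p01 i.
  rewrite /chernoff_factor indicE mem_set ?mulr1 ?lexx ?andbT//=; last first.
    by rewrite in_itv/= p0.
  by rewrite addr_ge0// mulr_ge0// ?invr_ge0// subr_ge0.
(* The limit passes to the odd indices because [k <= k.*2.+1]. *)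
- rewrite -[X in _ --> X]subr0; apply: cvgB; first exact: cvg_cst.
  apply: (cvg_comp _ _ _ cV) => A [M _ HM]; exists M => // k /= Mk.
  by apply: HM => /=; rewrite (leq_trans Mk)// -addnn -addnS leq_addr.
- exact: cvg_cst.
Qed.
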